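(* Let $f:\mathbb{R}^n\to\mathbb{R}$ be a $\mathcal{C}^1$ function whose gradient is Lipschitz continuous with constant $L>0$. Let $\{x^k\}_{k\ge1}\subset\mathbb{R}^n$ be generated from some $x^1\in\mathbb{R}^n$ by $$x^{k+1}=x^k-t_k\nabla f\left(x^k+\rho_k\frac{d^k}{\|d^k\|}\right),\qquad k=1,2,\ldots,$$ where $\{d^k\}\subset\mathbb{R}^n\setminus\{0\}$ and $\{\rho_k\},\{t_k\}\subset(0,\infty)$ satisfy $$\sum_{k=1}^\infty t_k=\infty,\qquad t_k\downarrow0,\qquad \sum_{k=1}^\infty t_k\rho_k<\infty,\qquad \limsup_{k\to\infty}\rho_k<\frac{2}{L}.$$ Assume that $\inf_{k\in\mathbb{N}}f(x^k)>-\infty$. Then the following convergence properties hold: (i) $\nabla f(x^k)\to 0$, and thus every accumulation point of $\{x^k\}$ is stationary for $f$. (ii) If $\bar x$ is an accumulation point of the sequence $\{x^k\}$, then $f(x^k)\to f(\bar x)$. (iii) Suppose that $f$ satisfies the KL property at some accumulation point $\bar x$ of $\{x^k\}$ with a desingularizing function $\varphi$ for which there is some $C>0$ such that $$C[\varphi'(x+y)]^{-1}\le(\varphi'(x))^{-1}+(\varphi'(y))^{-1}\quad\text{whenever }x,y\in(0,\eta)\text{ with }x+y<\eta.$$ Assume in addition that, with $\varepsilon_k:=L\rho_k$, $$\sum_{k=1}^\infty t_k\left(\varphi'\left(\sum_{i=k}^\infty t_i\varepsilon_i\right)\right)^{-1}<\infty,$$ and that $f(x^k)>f(\bar x)$ for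 all sufficiently large $k\in\mathbb{N}$. Then $x^k\to\bar x$ as $k\to\infty$. In particular, suppose (without assuming $f(x^k)>f(\bar x)$) that $f$ satisfies the KL property at some accumulation point $\bar x$ of $\{x^k\}$ with a desingularizing function $\varphi$ for which there is some $C>0$ such that $C[\varphi'(x+y)]^{-1}\le(\varphi'(x))^{-1}+(\varphi'(y))^{-1}$ whenever $x,y\in(0,\eta)$ with $x+y<\eta$, and that, with $\varepsilon_k:=L\rho_k$, $\sum_{k=1}^\infty t_k\left(\varphi'\left(\sum_{i=k}^\infty t_i\varepsilon_i\right)\right)^{-1}<\infty$; if $\bar x$ is a global minimizer of $f$, then either $f(x^k)=f(\bar x)$ for some $k\in\mathbb{N}$, or $x^k\to\bar x$.
   Context: $\mathbb{N}=\{1,2,\ldots\}$, and $\|\cdot\|$ is the Euclidean norm on $\mathbb{R}^n$. A point $\bar x$ is stationary for $f$ if $\nabla f(\bar x)=0$. The notation $t_k\downarrow0$ means that the positive numbers $t_k$ converge to $0$ (monotonicity is not required). KL (Kurdyka-Łojasiewicz) property: a smooth function $f:\mathbb{R}^n\to\mathbb{R}$ satisfies the KL property at $\bar x\in\mathbb{R}^n$ if there exist $\eta\in(0,\infty]$, a neighborhood $U$ of $\bar x$, and a concave continuous function $\varphi:[0,\eta)\to[0,\infty)$ (called a desingularizing function) such that $\varphi(0)=0$, $\varphi$ is $\mathcal{C}^1$-smooth on $(0,\eta)$, $\varphi'>0$ on $(0,\eta)$, and for all $x\in U$ with $0<f(x)-f(\bar x)<\eta$ one has $\varphi'(f(x)-f(\bar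 x))\|\nabla f(x)\|\ge1$. The number $\eta$ in (iii) is the one associated with $\varphi$. In the summability condition of (iii), $\varphi'$ is defined only on $(0,\eta)$; the finitely many terms for which $\sum_{i=k}^\infty t_i\varepsilon_i\ge\eta$ (if any) are disregarded. *)

(* Defs.v *)
From HB Require Import structures.
From mathcomp Require Import all_boot all_order all_algebra.
From mathcomp Require Import all_classical all_reals all_analysis.

Set Implicit Arguments.
Unset Strict Implicit.
Unset Printing Implicit Defensive.

Import Order.TTheory GRing.Theory Num.Theory.
Import numFieldNormedType.Exports.

Local Open Scope ring_scope.
Local Open Scope classical_set_scope.

(* The library's norm `|v| on 'rV[R]_n is the sup norm. *)
Definition enorm (R : realType) (n : nat) (v : 'rV[R]_n) : R :=
  Num.sqrt (\sum_(i < n) v 0 i ^+ 2).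

Definition grad (R : realType) (n : nat) (f : 'rV[R]_n -> R) (x : 'rV[R]_n) :
    'rV[R]_n :=
  \row_(i < n) 'D_(delta_mx 0 i) f x.

Definition C1_fun (R : realType) (n : nat) (f : 'rV[R]_n -> R) : Prop :=
  (forall x, differentiable f x) /\ continuous (grad f).

Definition lipschitz_grad (R : realType) (n : nat) (L : R)
    (f : 'rV[R]_n -> R) : Prop :=
  forall x y, enorm (grad f x - grad f y) <= L * enorm (x - y).

Definition stationary (R : realType) (n : nat) (f : 'rV[R]_n -> R)
    (x : 'rV[R]_n) : Prop :=
  grad f x = 0.

Definition accumulation_point (R : realType) (n : nat) (x : nat -> 'rV[R]_n)
    (xbar : 'rV[R]_n) : Prop :=
  cluster (x @ \oo) xbar.

(* A total phi : R -> R stands for a function on [0, eta) with eta in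
   (0, +oo]; its values outside [0, eta) are irrelevant. *)
Definition desingularizing (R : realType) (eta : \bar R) (phi : R -> R) :
    Prop :=
  let D0 := [set s : R | 0 <= s /\ (s%:E < eta)%E] in
  let D := [set s : R | 0 < s /\ (s%:E < eta)%E] in
  [/\ (0 < eta)%E /\ (forall s, D0 s -> 0 <= phi s),
      @convex_function R R^o D0 (fun s => - phi s) /\ {within D0, continuous phi},
      phi 0 = 0,
      forall s, D s -> derivable phi s 1 /\ {for s, continuous (derive1 phi)} &
      forall s, D s -> 0 < derive1 phi s].

Definition KL_with (R : realType) (n : nat) (f : 'rV[R]_n -> R)
    (xbar : 'rV[R]_n) (eta : \bar R) (phi : R -> R) : Prop :=
  desingularizing eta phi /\
  exists2 U : set 'rV[R]_n, nbhs xbar U &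
    forall x, U x -> 0 < f x - f xbar -> ((f x - f xbar)%:E < eta)%E ->
      1 <= derive1 phi (f x - f xbar) * enorm (grad f x).

Definition quasi_additive (R : realType) (eta : \bar R) (phi : R -> R) (C : R) :
    Prop :=
  forall s r : R, 0 < s -> (s%:E < eta)%E -> 0 < r -> (r%:E < eta)%E ->
    ((s + r)%:E < eta)%E ->
    C * (derive1 phi (s + r))^-1 <= (derive1 phi s)^-1 + (derive1 phi r)^-1.

Definition tail_sum (R : realType) (u : nat -> R) (k : nat) : \bar R :=
  (\sum_(k <= i <oo) (u i)%:E)%E.

(* phi' is only meaningful on (0, eta): indices k whose tail sum is not below
   eta are filtered out. *)
Definition summable_desing (R : realType) (eta : \bar R) (phi : R -> R)
    (t eps : nat -> R) : Prop :=
  let tail := tail_sum (fun i => t i * eps i) in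
  (\sum_(0 <= k <oo | (tail k < eta)%E)
     (t k * (derive1 phi (fine (tail k)))^-1)%:E < +oo)%E.

(* Main.v *)
Require Import Defs.
From HB Require Import structures.
From mathcomp Require Import all_boot all_order all_algebra.
From mathcomp Require Import all_classical all_reals all_analysis.
From mathcomp Require Import ring lra.

Import Order.TTheory GRing.Theory Num.Theory.
Import numFieldNormedType.Exports.

Set Implicit Arguments.
Unset Strict Implicit.

Local Open Scope ring_scope.
Local Open Scope classical_set_scope.

(** The gradient used at step [k] is [g k = grad f (x k) + e] with
[enorm e <= eps k := L * rho k], so the method is gradient descent with
absolute errors such that [limsup eps k < 2] and [w k := t k * eps k] is
summable.  All estimates below hold for large [k].

Decrease. The second-order error of a step is of order [t k] times the
first-order one, hence negligible.  At first order the error contributes the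
inner product of the gradient with [e]; Young's inequality with weight [eps k]
bounds it by half of [eps k * enorm (grad f (x k)) ^+ 2 + eps k].  The first
half is absorbed because [eps k] stays away from 2, the second is summable
after multiplication by [t k].  So the energy [Phi k = f (x k) + tail w k],
where [tail w] is the sequence of tails of the series of [w], decreases by at
least [c * t k * enorm (grad f (x k)) ^+ 2] ([sufficient_decrease]).  Being
bounded below, [Phi] converges, and therefore so does [f (x k)].

Gradients. One step increases the squared gradient norm by at most a multiple
of the same summable quantities ([grad_sqr_increment]).  Adding multiples of
[Phi] and [tail w] to the squared norm thus gives a nonincreasing sequence, and
the squared norms converge; since the [t k] are not summable, the limit is 0
([quasi_descent_cvg0]).

Convergence under KL. Let [D k] be the energy gap
[f (x k) - f xbar + tail w k].  Concavity turns the decrease of [D] into a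
decrease of [phi (D k)].  The slope of [phi] at [D k] is controlled by
quasi-additivity: its inverse is, up to [C], at most the sum of its inverses at
[f (x k) - f xbar], which the KL inequality bounds by the gradient norm, and at
[tail w k], which the summability condition handles.  The resulting bound on
the step length ([KL_step_length]) is telescoping:
[`|x k.+1 - x k| <= Psi k - Psi k.+1] with [Psi] tending to 0, as long as [x k]
is close to [xbar].  A sequence which comes close to [xbar] when [Psi] is small
can then never leave the neighbourhood again ([cvg_of_trapped_cluster]).

Euclidean estimates are made on squared norms, with Young's inequality, whose
weights are adapted to [eps k] and [t k].  Lengths of steps are measured in the
sup norm, which defines the topology of row vectors and is dominated by the
Euclidean norm. *)

(** * Euclidean geometry of row vectors *)

Definition dot (R : realType) (n : nat) (u v : 'rV[R]_n) : R :=
  \sum_(i < n) u 0 i * v 0 i.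

Lemma enorm_ge0 (R : realType) (n : nat) (v : 'rV[R]_n) : 0 <= enorm v.
Proof. exact: sqrtr_ge0. Qed.

Lemma enorm_sqr (R : realType) (n : nat) (v : 'rV[R]_n) :
  enorm v ^+ 2 = dot v v.
Proof.
rewrite sqr_sqrtr; last by apply: sumr_ge0 => i _; exact: sqr_ge0.
by apply: eq_bigr => i _; rewrite expr2.
Qed.

Lemma enormZ_sqr (R : realType) (n : nat) (c : R) (v : 'rV[R]_n) :
  enorm (c *: v) ^+ 2 = c ^+ 2 * enorm v ^+ 2.
Proof.
by rewrite !enorm_sqr mulr_sumr; apply: eq_bigr => i _; rewrite !mxE; ring.
Qed.

Lemma enormZ (R : realType) (n : nat) (c : R) (v : 'rV[R]_n) :
  enorm (c *: v) = `|c| * enorm v.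
Proof.
apply/eqP; rewrite -(@eqrXn2 _ 2) ?mulr_ge0 ?enorm_ge0//.
by rewrite enormZ_sqr exprMn real_normK ?num_real.
Qed.

Lemma enorm_eq0 (R : realType) (n : nat) (v : 'rV[R]_n) :
  (enorm v == 0) = (v == 0).
Proof.
apply/idP/eqP => [|->]; last first.
  by rewrite -sqrf_eq0 enorm_sqr /dot big1// => i _; rewrite mxE mul0r.
rewrite -sqrf_eq0 enorm_sqr /dot psumr_eq0; last first.
  by move=> i _; rewrite -expr2 sqr_ge0.
move=> /allP v0; apply/rowP => i; rewrite mxE; apply/eqP.
by have := v0 i (mem_index_enum _); rewrite mulf_eq0 orbb.
Qed.

Lemma normr_le_enorm (R : realType) (n : nat) (v : 'rV[R]_n) :
  `|v| <= enorm v.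
Proof.
rewrite /Num.Def.normr/= mx_normrE; apply: bigmax_le => [|[i j] _].
  exact: enorm_ge0.
rewrite ord1/= -(@ler_pXn2r _ 2) ?nnegrE ?enorm_ge0// enorm_sqr.
rewrite real_normK ?num_real// /dot (bigD1 j)//= -expr2 lerDl.
by apply: sumr_ge0 => k _; rewrite -expr2 sqr_ge0.
Qed.

Lemma dotDr (R : realType) (n : nat) (u v w : 'rV[R]_n) :
  dot u (v + w) = dot u v + dot u w.
Proof.
by rewrite -big_split/=; apply: eq_bigr => i _; rewrite !mxE mulrDr.
Qed.

Lemma dotDl (R : realType) (n : nat) (u v w : 'rV[R]_n) :
  dot (u + v) w = dot u w + dot v w.
Proof.
by rewrite -big_split/=; apply: eq_bigr => i _; rewrite !mxE mulrDl.
Qed.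

Lemma dotZr (R : realType) (n : nat) (c : R) (u v : 'rV[R]_n) :
  dot u (c *: v) = c * dot u v.
Proof. by rewrite mulr_sumr; apply: eq_bigr => i _; rewrite !mxE mulrCA. Qed.

(** The difference of the two sides is a sum of squares
[s^-1 * (s * u_i +- v_i) ^+ 2].  The free weight [s] decides which of the two
squares is to be absorbed elsewhere. *)
Lemma young_dot (R : realType) (n : nat) (s : R) (u v : 'rV[R]_n) :
  0 < s -> `|2 * dot u v| <= s * enorm u ^+ 2 + s^-1 * enorm v ^+ 2.
Proof.
move=> s0; rewrite !enorm_sqr /dot !mulr_sumr -big_split/=.
apply: le_trans (ler_norm_sum _ _ _) _; apply: ler_sum => i _.
set a := u 0 i; set b := v 0 i; rewrite ler_norml; apply/andP; split.
  rewrite -subr_ge0.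
  have -> : 2 * (a * b) - - (s * (a * a) + s^-1 * (b * b)) =
            s^-1 * (s * a + b) ^+ 2 by field; rewrite gt_eqF.
  by rewrite mulr_ge0 ?sqr_ge0// invr_ge0 ltW.
rewrite -subr_ge0.
have -> : s * (a * a) + s^-1 * (b * b) - 2 * (a * b) =
          s^-1 * (s * a - b) ^+ 2 by field; rewrite gt_eqF.
by rewrite mulr_ge0 ?sqr_ge0// invr_ge0 ltW.
Qed.

Lemma enormD_sqr_le (R : realType) (n : nat) (s : R) (u v : 'rV[R]_n) :
  0 < s ->
  enorm (u + v) ^+ 2 <= (1 + s) * enorm u ^+ 2 + (1 + s^-1) * enorm v ^+ 2.
Proof.
move=> s0; have := young_dot u v s0; rewrite !enorm_sqr.
have -> : dot (u + v) (u + v) = dot u u + 2 * dot u v + dot v v.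
  rewrite /dot mulr_sumr -!big_split/=; apply: eq_bigr => i _.
  by rewrite !mxE; ring.
move=> /(le_trans (ler_norm _)); lra.
Qed.

(** * First-order estimates for one step *)

Lemma derive_dot (R : realType) (n : nat) (f : 'rV[R]_n -> R)
    (x v : 'rV[R]_n) :
  differentiable f x -> 'D_v f x = dot (grad f x) v.
Proof.
move=> df; rewrite deriveE// {1}[v]row_sum_delta linear_sum/=.
by apply: eq_bigr => i _; rewrite linearZ/= mxE deriveE// mulrC.
Qed.

Lemma is_derive_along_line (R : realType) (n : nat) (f : 'rV[R]_n -> R)
    (x v : 'rV[R]_n) (s : R) :
  differentiable f (x + s *: v) ->
  is_derive s 1 (fun r => f (x + r *: v)) (dot (grad f (x + s *: v)) v).
Proof.
move=> df.
have eqq : (fun h : R => h^-1 *: (f (x + (h *: 1 + s) *: v) - f (x + s *: v)))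
   = (fun h => h^-1 *: (f (h *: v + (x + s *: v)) - f (x + s *: v))).
  apply/funext => h; congr (_ *: (f _ - _)).
  by rewrite scalerDl addrCA [h *: 1]mulr1.
split.
- rewrite /derivable/= eqq; exact: diff_derivable.
- by rewrite -derive_dot// /derive/= eqq.
Qed.

(** The mean value theorem on the segment, the gradient at the intermediate
point being within [L * enorm v] of the one at [x].  The constant is twice the
optimal one; this is harmless because [v] will be a gradient times a stepsize
tending to 0, which makes the quadratic term negligible. *)
Lemma descent_lemma (R : realType) (n : nat) (f : 'rV[R]_n -> R) (L : R)
    (x v : 'rV[R]_n) :
  0 < L -> (forall y, differentiable f y) -> lipschitz_grad L f ->
  f (x + v) <= f x + dot (grad f x) v + L * enorm v ^+ 2.
Proof.
move=> L0 df fL.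
have dg s := is_derive_along_line (df (x + s *: v)).
have cg : {within `[0, 1], continuous (fun r : R => f (x + r *: v))}.
  apply: continuous_subspaceT => s; apply: differentiable_continuous.
  apply/derivable1_diffP; exact: ex_derive.
have [c c01] := MVT ltr01 (fun s _ => dg s) cg.
rewrite scale1r scale0r addr0 subr0 mulr1 => /eqP.
rewrite subr_eq => /eqP ->; rewrite [leLHS]addrC -addrA lerD2l.
have {1}-> : grad f (x + c *: v) =
    grad f x + (grad f (x + c *: v) - grad f x) by rewrite addrCA subrr addr0.
rewrite dotDl lerD2l.
set w := grad f _ - _.
have wv : enorm w ^+ 2 <= L ^+ 2 * enorm v ^+ 2.
  rewrite -exprMn ler_pXn2r ?nnegrE ?mulr_ge0 ?enorm_ge0 ?(ltW L0)//.
  apply: le_trans (fL _ _) _; rewrite addrC addKr enormZ ler_pM2l//.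
  move: c01; rewrite in_itv/= => /andP[c0 c1].
  by rewrite gtr0_norm// ler_piMl ?enorm_ge0// ltW.
have Li0 : 0 < L^-1 by rewrite invr_gt0.
have := young_dot w v Li0; rewrite invrK.
move=> /(le_trans (ler_norm _)).
have : L^-1 * enorm w ^+ 2 <= L * enorm v ^+ 2.
  by rewrite ler_pdivrMl// mulrA -expr2.
by lra.
Qed.

(** The bound [eps <= 2 - 4 * c] leaves a fraction [2 * c] of the squared
gradient after Young's inequality has absorbed the inner product of gradient
and error; a small [t] makes the quadratic term eat at most half of it. *)
Lemma sufficient_decrease (R : realType) (n : nat) (f : 'rV[R]_n -> R)
    (L t eps c : R) (x g : 'rV[R]_n) :
  0 < L -> (forall y, differentiable f y) -> lipschitz_grad L f ->
  0 < t -> 0 < eps -> eps <= 2 - 4 * c -> 2 * L * t <= c -> 8 * L * t <= 1 ->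
  enorm (g - grad f x) <= eps ->
  f (x - t *: g) <= f x - c * t * enorm (grad f x) ^+ 2 + t * eps.
Proof.
move=> L0 df fL t0 e0 ec tc t8 ge.
have c1 : eps <= 2.
  have : 0 < 2 * L * t by rewrite !mulr_gt0.
  lra.
set p := grad f x in ge *; set e := g - p in ge.
have gE : g = p + e by rewrite /e addrCA subrr addr0.
have eE : enorm e ^+ 2 <= eps ^+ 2.
  by rewrite ler_pXn2r ?nnegrE ?enorm_ge0 ?(ltW e0).
have := descent_lemma x (- t *: g) L0 df fL.
rewrite -/p dotZr enormZ_sqr sqrrN scaleNr {2 3}gE dotDr -enorm_sqr.
move=> /le_trans; apply.
have := young_dot p e e0; rewrite ler_norml => /andP[+ _].
have := enormD_sqr_le p e ltr01; rewrite invr1.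
have : eps^-1 * enorm e ^+ 2 <= eps by rewrite ler_pdivrMl// -expr2.
have := sqr_ge0 (enorm p).
move: (enorm p ^+ 2) (enorm e ^+ 2) (enorm (p + e) ^+ 2) (dot p e) eE
  => a E G s eE a0 Ee GE sE.
have GE' : G <= 2 * a + 4 * eps.
  have : eps ^+ 2 <= 2 * eps by rewrite expr2 ler_pM2r.
  lra.
have h1 : L * t * G <= L * t * (2 * a + 4 * eps).
  by rewrite ler_pM2l ?mulr_gt0.
have h2 : (2 * L * t) * a <= c * a by rewrite ler_wpM2r.
have h3 : (8 * L * t) * eps <= 1 * eps by rewrite ler_pM2r.
have h4 : eps * a <= (2 - 4 * c) * a by rewrite ler_wpM2r.
have key : - (a + s) + L * t * G <= - (c * a) + eps by lra.
have : t * (- (a + s) + L * t * G) <= t * (- (c * a) + eps) by rewrite ler_pM2l.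
lra.
Qed.

(** Young's inequality with weight [t]: the change of gradient has length at
most [L * t * enorm g], so that [(1 + t^-1)] times its square is still of
order [t]. *)
Lemma grad_sqr_increment (R : realType) (n : nat) (f : 'rV[R]_n -> R)
    (L t eps : R) (x g : 'rV[R]_n) :
  lipschitz_grad L f -> 0 < L -> 0 < t -> t <= 1 -> 0 < eps -> eps <= 2 ->
  enorm (g - grad f x) <= eps ->
  enorm (grad f (x - t *: g)) ^+ 2 <=
  enorm (grad f x) ^+ 2
    + (1 + 8 * L ^+ 2) * (t * enorm (grad f x) ^+ 2 + t * eps).
Proof.
move=> fL L0 t0 t1 e0 e2 ge.
set p := grad f x in ge *; set e := g - p in ge.
have gE : g = p + e by rewrite /e addrCA subrr addr0.
have eE : enorm e ^+ 2 <= eps ^+ 2.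
  by rewrite ler_pXn2r ?nnegrE ?enorm_ge0 ?(ltW e0).
set p' := grad f _; set q := p' - p.
have -> : p' = p + q by rewrite /q addrCA subrr addr0.
have qE : enorm q ^+ 2 <= L ^+ 2 * t ^+ 2 * enorm g ^+ 2.
  rewrite -mulrA -enormZ_sqr -exprMn ler_pXn2r ?nnegrE ?mulr_ge0 ?enorm_ge0
    ?(ltW L0) ?(ltW t0)//.
  apply: le_trans (fL _ _) _.
  by rewrite addrAC subrr add0r -scaleNr !enormZ normrN.
have := enormD_sqr_le p q t0.
have := enormD_sqr_le p e ltr01; rewrite invr1 -gE.
have := sqr_ge0 (enorm p).
move: (enorm p ^+ 2) (enorm e ^+ 2) (enorm g ^+ 2) (enorm q ^+ 2) eE qE
  => a E G Q eE QE a0 GE /le_trans; apply.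
have GE' : G <= 2 * a + 4 * eps.
  have : eps ^+ 2 <= 2 * eps by rewrite expr2 ler_pM2r.
  lra.
have L20 : 0 < L ^+ 2 by rewrite exprn_gt0.
have ht : (1 + t^-1) * Q <= 2 * t * L ^+ 2 * (2 * a + 4 * eps).
  apply: (@le_trans _ _ ((1 + t^-1) * (L ^+ 2 * t ^+ 2 * (2 * a + 4 * eps)))).
    apply: ler_wpM2l; first by rewrite addr_ge0 ?invr_ge0 ?ltW.
    apply: le_trans QE _; apply: ler_wpM2l => //.
    by rewrite mulr_ge0// sqr_ge0.
  have -> : (1 + t^-1) * (L ^+ 2 * t ^+ 2 * (2 * a + 4 * eps)) =
      (1 + t) * t * L ^+ 2 * (2 * a + 4 * eps) by field; rewrite gt_eqF.
  apply: ler_wpM2r; first lra.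
  by rewrite ler_wpM2r ?sqr_ge0// ler_wpM2r ?(ltW t0)//; lra.
have : 0 <= L ^+ 2 * (t * a) by rewrite !mulr_ge0 // ltW.
have : 0 <= t * eps by rewrite mulr_ge0 // ltW.
lra.
Qed.

(** * Tails of series and quasi-monotone sequences *)

Definition tail (R : realType) (w : nat -> R) (k : nat) : R :=
  fine (tail_sum w k).

Section tail.
Context (R : realType) (w : nat -> R).
Context (w_ge0 : forall k, 0 <= w k).
Context (w_sum : (\sum_(0 <= k <oo) (w k)%:E < +oo)%E).

Let tail_sum_ge0 k : (0 <= tail_sum w k)%E.
Proof. by apply: nneseries_ge0 => i _ _; rewrite lee_fin. Qed.

Lemma tail_sumE k : tail_sum w k = (tail w k)%:E.
Proof.
rewrite fineK// ge0_fin_numE//; apply: le_lt_trans w_sum.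
rewrite (@nneseries_split _ _ 0 k); last by move=> i _; rewrite lee_fin.
rewrite add0n leeDr//; apply: sume_ge0 => i _; by rewrite lee_fin.
Qed.

Lemma tail_ge0 k : 0 <= tail w k.
Proof. by rewrite -lee_fin -tail_sumE. Qed.

Lemma tailS k : tail w k = w k + tail w k.+1.
Proof.
apply: EFin_inj; rewrite EFinD -!tail_sumE.
rewrite /tail_sum (@nneseries_split _ _ k 1) ?addn1 ?big_nat1//.
by move=> i _; rewrite lee_fin.
Qed.

Lemma tail_cvg0 : tail w @ \oo --> (0 : R).
Proof.
have /fine_cvg : tail_sum w @ \oo --> (0 : R)%:E; last exact.
by apply: nneseries_tail_cvg => // k _; rewrite lee_fin.
Qed.

End tail.

Lemma tail_gt0 (R : realType) (w : nat -> R) (k : nat) :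
  (forall k, 0 < w k) -> (\sum_(0 <= k <oo) (w k)%:E < +oo)%E -> 0 < tail w k.
Proof.
move=> w0 ws; have w0' j := ltW (w0 j).
by rewrite tailS// ltr_pwDl ?tail_ge0.
Qed.

Lemma near_nonincreasing_step_cvg (R : realType) (V : nat -> R) (m : R) :
  (\forall k \near \oo, V k.+1 <= V k) -> (\forall k \near \oo, m <= V k) ->
  cvgn V.
Proof.
move=> [N _ VN]; apply: near_nonincreasing_is_cvgn.
exists N => // i /= Ni j /subnKC <-; elim: (j - i)%N => [|k IH].
  by rewrite addn0.
rewrite addnS; apply: le_trans IH; apply: VN => /=.
by rewrite (leq_trans Ni)// leq_addr.
Qed.

Lemma series_lty_of_telescope (R : realType) (s V : nat -> R) (m : R) :
  (forall k, 0 <= s k) ->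
  (\forall k \near \oo, s k <= V k - V k.+1) ->
  (\forall k \near \oo, m <= V k) ->
  (\sum_(0 <= k <oo) (s k)%:E < +oo)%E.
Proof.
move=> s0 [N _ sV] [M _ mV]; set K := (N + M)%N.
rewrite (@nneseries_split _ _ 0 K); last by move=> k _; rewrite lee_fin.
rewrite sumEFin lte_add_pinfty ?ltry// add0n.
apply: (@le_lt_trans _ _ (V K - m)%:E); last exact: ltry.
apply: lime_le; first by apply: is_cvg_nneseries => k _ _; rewrite lee_fin.
near=> n; rewrite sumEFin lee_fin.
have Kn : (K <= n)%N by near: n; exact: nbhs_infty_ge.
apply: (@le_trans _ _ (\sum_(K <= k < n) (V k - V k.+1))).
  rewrite big_nat [leRHS]big_nat; apply: ler_sum => k /andP[Kk _].
  by apply: sV; rewrite /= (leq_trans _ Kk)// leq_addr.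
rewrite (@telescope_sumr_eq _ _ _ (fun k => - V k))//; last first.
  by move=> k _; rewrite opprK addrC.
rewrite opprK addrC lerD2l lerN2; apply: mV.
by rewrite /= (leq_trans _ Kn)// leq_addl.
Unshelve. all: by end_near. Qed.

(** The sequence [a + C / c * Phi + C * u] is nonincreasing, because the
increments of [a] are paid for by the decrements of [Phi] and [u]; hence [a]
converges.  A positive limit would bound [t] by a multiple of the decrements of
[Phi] and make it summable. *)
Lemma quasi_descent_cvg0 (R : realType) (t a Phi u : nat -> R) (c C m : R) :
  0 < c -> 0 < C -> (forall k, 0 < t k) -> (forall k, 0 <= a k) ->
  (forall k, 0 <= u k) -> cvgn u ->
  (\sum_(0 <= k <oo) (t k)%:E = +oo)%E ->
  (\forall k \near \oo, m <= Phi k) ->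
  (\forall k \near \oo, c * t k * a k <= Phi k - Phi k.+1) ->
  (\forall k \near \oo, a k.+1 <= a k + C * (t k * a k + (u k - u k.+1))) ->
  a @ \oo --> (0 : R).
Proof.
move=> c0 C0 t0 a0 u0 cu tsum Phim dec inc.
have c_neq0 : c != 0 by rewrite gt_eqF.
have ca : cvgn a.
  have cPhi : cvgn Phi.
    apply: near_nonincreasing_step_cvg Phim.
    apply: filterS dec => k; rewrite -[Phi k.+1 <= _]subr_ge0; apply: le_trans.
    by rewrite !mulr_ge0// ltW.
  (* [a] is the difference of a monotone sequence and a convergent one. *)
  have -> : a = (fun k => a k + C / c * Phi k + C * u k)
      - ((fun k => C / c * Phi k) + (fun k => C * u k)).
    by apply/funext => k; rewrite !fctE; ring.
  apply: is_cvgB; last by apply: is_cvgD; apply: is_cvgM => //; exact: is_cvg_cst.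
  apply: (@near_nonincreasing_step_cvg _ _ (C / c * m)).
    near=> k.
    have dk : c * t k * a k <= Phi k - Phi k.+1 by near: k.
    have : a k.+1 <= a k + C * (t k * a k + (u k - u k.+1)) by near: k.
    have : C / c * (c * t k * a k) <= C / c * (Phi k - Phi k.+1).
      by rewrite ler_wpM2l// divr_ge0// ltW.
    have -> : C / c * (c * t k * a k) = C * (t k * a k) by field.
    lra.
  near=> k.
  have : C / c * m <= C / c * Phi k.
    by rewrite ler_wpM2l ?divr_ge0 ?(ltW c0) ?(ltW C0)//; near: k.
  have : 0 <= C * u k by rewrite mulr_ge0// ltW.
  have := a0 k; lra.
set l := limn a; suff : l = 0 by move=> <-.
have l0 : 0 <= l by apply: limr_ge => //; exact: nearW.
apply/eqP; rewrite eq_le l0 andbT leNgt; apply/negP => lp.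
have K0 : 0 < 2 / (c * l) by rewrite divr_gt0 ?mulr_gt0.
have : (\sum_(0 <= k <oo) (t k)%:E < +oo)%E.
  apply: (@series_lty_of_telescope _ _ (fun k => 2 / (c * l) * Phi k)
      (2 / (c * l) * m)).
  - by move=> k; exact: ltW.
  - have al : \forall k \near \oo, l / 2 <= a k.
      have : l / 2 < l by lra.
      by move=> /(cvgr_ge l ca).
    near=> k.
    have dk : c * t k * a k <= Phi k - Phi k.+1 by near: k.
    have ak : l / 2 <= a k by near: k.
    rewrite -mulrBr.
    have : 2 / (c * l) * (c * t k * (l / 2)) <= 2 / (c * l) * (Phi k - Phi k.+1).
      rewrite ler_pM2l//; apply: le_trans dk.
      by rewrite ler_wpM2l// mulr_ge0// ltW.
    apply: le_trans; rewrite le_eqVlt; apply/orP; left; apply/eqP.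
    by field; rewrite c_neq0 gt_eqF.
  - by apply: filterS Phim => k; rewrite ler_pM2l.
by rewrite tsum.
Unshelve. all: by end_near. Qed.

Lemma near_le_of_limn_esup_lt (R : realType) (u : nat -> R) (l : R) :
  (limn_esup (fun k => (u k)%:E) < l%:E)%E ->
  exists2 m, m < l & \forall k \near \oo, u k <= m.
Proof.
move=> /ereal_inf_lt[_ [A Aoo <-]] supl.
have uA k : A k -> ((u k)%:E <= ereal_sup [set (u k)%:E | k in A])%E.
  by move=> Ak; apply: ereal_sup_ubound; exists k.
move: supl uA; case: (ereal_sup _) => [s| |]//.
- rewrite lte_fin => sl uA; exists s => //.
  by apply: filterS Aoo => k /uA; rewrite lee_fin.
- move=> _ uA; exists (l - 1); first by rewrite ltrBlDr ltrDl.
  by apply: filterS Aoo => k /uA.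
Qed.

(** * Cluster points of sequences *)

Lemma cvg_image_cluster (T U : topologicalType) (x : nat -> T) (g : T -> U)
    (xbar : T) (l : U) :
  hausdorff_space U -> cluster (x @ \oo) xbar -> {for xbar, continuous g} ->
  g (x k) @[k --> \oo] --> l -> l = g xbar.
Proof.
move=> hU clx gc gl; apply: hU; apply: (cvg_cluster gl) => A B Aoo /gc gB.
by have [k [gA gBk]] := clx (g @^-1` A) _ Aoo gB; exists (g k).
Qed.

(** As long as the sequence stays in the ball,
[`|xbar - x k| + Psi k] does not increase.  Started at an index where it is
less than the radius, it keeps the sequence in the ball.  Cluster points supply
such indices for arbitrarily small radii. *)
Lemma cvg_of_trapped_cluster (R : realType) (V : normedModType R)
    (x : nat -> V) (xbar : V) (Psi : nat -> R) (r : R) :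
  0 < r -> Psi @ \oo --> (0 : R) ->
  (\forall k \near \oo, 0 <= Psi k) ->
  (\forall k \near \oo, `|xbar - x k| < r ->
     `|x k.+1 - x k| <= Psi k - Psi k.+1) ->
  cluster (x @ \oo) xbar -> x @ \oo --> xbar.
Proof.
move=> r0 Psi0 Psi_ge0 step clx; apply/cvgrPdist_lt => e e0.
pose d := Num.min e r.
have d0 : 0 < d by rewrite lt_min e0.
have [N _ PN] : \forall k \near \oo, [/\ 0 <= Psi k, Psi k < d / 2 &
    `|xbar - x k| < r -> `|x k.+1 - x k| <= Psi k - Psi k.+1].
  near=> k; split; [by near: k| |by near: k].
  by near: k; apply: (cvgr_lt 0) => //; rewrite divr_gt0.
(* Start at an index [K] with both [x K] close to [xbar] and [Psi K] small. *)
have [_ [[K /= NK <-]]] := clx (x @` [set k | (N <= k)%N]) (ball xbar (d / 2))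
  (ex_intro2 _ _ N I (fun k Nk => ex_intro2 _ _ k Nk erefl))
  (nbhsx_ballx _ _ (divr_gt0 d0 (ltr0Sn _ 1))).
rewrite -ball_normE/= => xK.
have [_ PsiK _] := PN K NK.
have inv j : `|xbar - x (K + j)%N| + Psi (K + j)%N <= `|xbar - x K| + Psi K.
  elim: j => [|j IH]; first by rewrite addn0.
  have NKj : (N <= K + j)%N by rewrite (leq_trans NK)// leq_addr.
  have [Pj _ stepj] := PN _ NKj.
  have xj : `|xbar - x (K + j)%N| < r.
    have dr : d <= r by rewrite ge_min lexx orbT.
    lra.
  have := stepj xj; rewrite addnS.
  have := ler_distD (x (K + j)%N) xbar (x (K + j).+1).
  rewrite [`|x (K + j)%N - _|]distrC; lra.
exists K => // j /= /subnKC <-.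
have [Pj _ _] := PN _ (leq_trans NK (leq_addr (j - K) K)).
have := inv (j - K)%N.
have de : d <= e by rewrite ge_min lexx.
lra.
Unshelve. all: by end_near. Qed.

(** * Desingularizing functions *)

Lemma desingularizing_concave (R : realType) (eta : \bar R) (phi : R -> R)
    (x y l : R) :
  desingularizing eta phi ->
  0 <= x -> (x%:E < eta)%E -> 0 <= y -> (y%:E < eta)%E -> 0 <= l -> l <= 1 ->
  l * phi y + (1 - l) * phi x <= phi (l * y + (1 - l) * x).
Proof.
case=> _ [+ _] _ _ _ x0 xe y0 ye l0 l1.
move=> /(_ (Itv01 l0 l1) y x); rewrite !inE => /(_ (conj y0 ye) (conj x0 xe)) H.
have : - phi (l * y + (1 - l) * x) <= l * - phi y + (1 - l) * - phi x := H.
lra.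
Qed.

(** A concave function has slope at [x] at most its slope over [[y, x]]: the
difference quotients from the left at [x] are bounded by the latter. *)
Lemma desingularizing_tangent (R : realType) (eta : \bar R) (phi : R -> R)
    (x y : R) :
  desingularizing eta phi -> 0 < x -> (x%:E < eta)%E -> 0 <= y -> y <= x ->
  derive1 phi x * (x - y) <= phi x - phi y.
Proof.
move=> dphi x0 xe y0; rewrite le_eqVlt => /predU1P[->|yx].
  by rewrite !subrr mulr0.
have ye : (y%:E < eta)%E by apply: le_lt_trans xe; rewrite lee_fin ltW.
have xy0 : 0 < x - y by rewrite subr_gt0.
rewrite -ler_pdivlMr//.
have dx : derivable phi x 1.
  by case: dphi => _ _ _ /(_ x (conj x0 xe))[].
rewrite derive1E /derive (cvg_at_leftE _ _ dx).
apply: limr_le.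
  apply: cvgP; apply: cvg_trans dx; apply: cvg_app => A.
  by apply: (@filterS _ (nbhs (0 : R))) => h hA h0; apply: hA; rewrite lt_eqF.
near=> h.
have h0 : h < 0 by near: h; exact: nbhs_left_lt.
have hy : y - x <= h.
  by near: h; apply: nbhs_left_ge; rewrite subr_lt0.
have hneq : h != 0 by rewrite lt_eqF.
have xyneq : x - y != 0 by rewrite gt_eqF.
have l0 : 0 <= - h / (x - y) by rewrite divr_ge0 ?oppr_ge0 ?(ltW h0) ?(ltW xy0).
have l1 : - h / (x - y) <= 1 by rewrite ler_pdivrMr// mul1r; lra.
have := desingularizing_concave dphi (ltW x0) xe y0 ye l0 l1.
have -> : - h / (x - y) * y + (1 - - h / (x - y)) * x = h *: 1 + x.
  by rewrite /GRing.scale/=; field.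
move=> cc; rewrite /GRing.scale/= -/(GRing.scale h 1).
rewrite mulrC ler_ndivrMr//.
have -> : (phi x - phi y) / (x - y) * h =
   - h / (x - y) * phi y + (1 - - h / (x - y)) * phi x - phi x by field.
by rewrite lerD2r.
Unshelve. all: by end_near. Qed.

Lemma desingularizing_cvg0 (R : realType) (eta : \bar R) (phi : R -> R)
    (D : nat -> R) :
  desingularizing eta phi -> D @ \oo --> (0 : R) ->
  (\forall k \near \oo, 0 <= D k /\ ((D k)%:E < eta)%E) ->
  phi (D k) @[k --> \oo] --> (0 : R).
Proof.
case=> -[eta0 _] [_ /subspace_continuousP phic] phi00 _ _ D0 Dnear.
have phi0 := phic 0 (conj (lexx 0) eta0).
rewrite -[X in _ --> X]phi00 => A /phi0 phiA.
have := D0 _ phiA; rewrite /= => DA.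
rewrite /fmap/= /nbhs/=.
by apply: (@filterS2 _ \oo _ _ _ _ _ DA Dnear) => k Ak Dk; exact: Ak.
Qed.

(** Write [p] for the gradient norm, [q] for the inverse slope at [u] and
[del] for the decrement of [phi].  Tangent inequality, quasi-additivity and KL
combine into [c * C * t * p ^+ 2 <= del * (p + q)].  An inequality
[p ^+ 2 <= A * (p + q)] with [A], [p], [q] nonnegative implies [p <= A + q], since [p > A + q] would
give [p ^+ 2 > A * p + q * p >= A * p + q * A]. *)
Lemma KL_step_length (R : realType) (eta : \bar R) (phi : R -> R)
    (C c t F u D' p : R) :
  desingularizing eta phi -> quasi_additive eta phi C ->
  0 < C -> 0 < c -> 0 < t -> 0 <= p -> 0 < F -> 0 < u -> ((F + u)%:E < eta)%E ->
  0 <= D' -> 1 <= derive1 phi F * p -> c * t * p ^+ 2 <= F + u - D' ->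
  t * p <= (c * C)^-1 * (phi (F + u) - phi D') + t * (derive1 phi u)^-1.
Proof.
move=> dphi qa C0 c0 t0 p0 F0 u0 Dlt D'0 KL dec.
have D0 : 0 < F + u by rewrite addr_gt0.
have Flt : (F%:E < eta)%E.
  by apply: le_lt_trans Dlt; rewrite lee_fin lerDl ltW.
have ult : (u%:E < eta)%E.
  by apply: le_lt_trans Dlt; rewrite lee_fin lerDr ltW.
have pos s : 0 < s -> (s%:E < eta)%E -> 0 < derive1 phi s.
  by case: dphi => _ _ _ _ + s0 sl; apply.
have phiF := pos _ F0 Flt; have phiu := pos _ u0 ult; have phiD := pos _ D0 Dlt.
have D'D : D' <= F + u.
  by rewrite -subr_ge0; apply: le_trans dec; apply: mulr_ge0 (sqr_ge0 p);
    exact: mulr_ge0 (ltW c0) (ltW t0).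
have := desingularizing_tangent dphi D0 Dlt D'0 D'D.
have := qa _ _ F0 Flt u0 ult Dlt.
have : (derive1 phi F)^-1 <= p by rewrite -[leLHS]mulr1 ler_pdivrMl.
set del := phi (F + u) - phi D'; set q := (derive1 phi u)^-1.
have q0 : 0 < q by rewrite invr_gt0.
move: (derive1 phi (F + u)) phiD => dD dD0 Fp qaD tan.
have del0 : 0 <= del by apply: le_trans tan; rewrite mulr_ge0 ?subr_ge0 ?(ltW dD0).
have cC0 : 0 < c * C by rewrite mulr_gt0.
have h1 : c * C * t * p ^+ 2 <= del * (p + q).
  apply: (@le_trans _ _ (del * (C * dD^-1))); last by rewrite ler_wpM2l//; lra.
  apply: (@le_trans _ _ ((dD * (c * t * p ^+ 2)) * (C * dD^-1))).
    by rewrite le_eqVlt; apply/orP; left; apply/eqP; field; rewrite gt_eqF.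
  rewrite ler_wpM2r ?mulr_ge0 ?invr_ge0 ?(ltW C0) ?(ltW dD0)//.
  by apply: le_trans tan; rewrite ler_pM2l.
rewrite -(ler_pM2l cC0) mulrDr mulVKf ?gt_eqF// leNgt; apply/negP => lt1.
have p_gt0 : 0 < p.
  rewrite lt_neqAle p0 andbT eq_sym; apply: contraTneq KL => ->.
  by rewrite mulr0 -ltNge.
have : (del + c * C * (t * q)) * p < c * C * (t * p) * p by rewrite ltr_pM2r.
have : del * q <= c * C * (t * p) * q.
  rewrite ler_pM2r//; apply: ltW; apply: le_lt_trans lt1.
  by rewrite lerDl !mulr_ge0 ?ltW.
rewrite expr2 in h1; lra.
Qed.

(** * Convergence of the iterates *)

(** The potential [Psi] collects the three telescoping terms that bound a step:
the decrement of [phi (D k)], the inverse slopes at the tails, and the gradient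
errors [w]. *)
Lemma KL_convergence (R : realType) (n : nat) (f : 'rV[R]_n -> R)
    (x : nat -> 'rV[R]_n) (xbar : 'rV[R]_n) (t w : nat -> R) (c C : R)
    (eta : \bar R) (phi : R -> R) :
  (forall k, 0 < t k) -> (forall k, 0 < w k) ->
  (\sum_(0 <= k <oo) (w k)%:E < +oo)%E -> 0 < c ->
  (\forall k \near \oo, c * t k * enorm (grad f (x k)) ^+ 2 <=
     (f (x k) + tail w k) - (f (x k.+1) + tail w k.+1)) ->
  (\forall k \near \oo,
     `|x k.+1 - x k| <= t k * enorm (grad f (x k)) + w k) ->
  f (x k) @[k --> \oo] --> f xbar ->
  accumulation_point x xbar ->
  KL_with f xbar eta phi -> 0 < C -> quasi_additive eta phi C ->
  (\sum_(0 <= k <oo | (tail_sum w k < eta)%E)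
     (t k * (derive1 phi (fine (tail_sum w k)))^-1)%:E < +oo)%E ->
  (\forall k \near \oo, f xbar < f (x k)) ->
  x @ \oo --> xbar.
Proof.
move=> t0 w0 wsum c0 dec step fcvg clx [dphi [U /nbhs_ballP[r /= r0 rU] KL]].
move=> C0 qa.
have w0' k : 0 <= w k := ltW (w0 k).
have u0 k : 0 < tail w k by exact: tail_gt0.
have eta0 : (0 < eta)%E by case: dphi => -[].
have dpos s : 0 < s -> (s%:E < eta)%E -> 0 < derive1 phi s.
  by case: dphi => _ _ _ _ + s0 sl; apply.
(* Indices with a tail outside the domain contribute 0, which keeps [v]
   nonnegative everywhere. *)
pose v k := if (tail_sum w k < eta)%E then t k * (derive1 phi (tail w k))^-1
            else 0.
have v0 k : 0 <= v k.
  rewrite /v; case: ifPn => // ueta.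
  rewrite mulr_ge0 ?(ltW (t0 k))// invr_ge0 ltW// dpos//.
  by rewrite -tail_sumE.
rewrite eseries_mkcond (eq_eseriesr (g := fun k => (v k)%:E)); last first.
  by move=> k _; rewrite /v; case: (tail_sum w k < eta)%E.
move=> vsum above.
have ucvg := tail_cvg0 w0' wsum.
pose D k := f (x k) - f xbar + tail w k.
have Dcvg : D @ \oo --> (0 : R).
  rewrite -[0]addr0 -{1}(subrr (f xbar)).
  by apply: cvgD => //; apply: cvgB => //; exact: cvg_cst.
have Deta : \forall k \near \oo, ((D k)%:E < eta)%E.
  case: eta eta0 {dphi KL qa dpos v v0 vsum} => [e| |]//=.
    by rewrite lte_fin => e0; apply: cvgr_lt Dcvg _ _; rewrite ?lte_fin.
  by move=> _; apply: nearW => k; exact: ltry.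
have D0 : \forall k \near \oo, 0 <= D k.
  by near=> k; rewrite addr_ge0 ?(ltW (u0 k))// subr_ge0 ltW//; near: k.
have D0S : \forall k \near \oo, 0 <= D k.+1.
  by case: D0 => N _ DN; exists N => // k Nk; apply: DN; exact: leqW.
have phiD : phi (D k) @[k --> \oo] --> (0 : R).
  by apply: (desingularizing_cvg0 dphi Dcvg); near=> k; split; near: k.
pose Psi k := (c * C)^-1 * phi (D k) + tail v k + tail w k.
apply: (@cvg_of_trapped_cluster _ _ _ _ Psi r) => //.
- rewrite -[0]addr0 -[X in X + _]addr0 -{1}(mulr0 (c * C)^-1).
  apply: cvgD => //; apply: cvgD; last exact: tail_cvg0.
  by apply: cvgM => //; exact: cvg_cst.
- near=> k.
  rewrite /Psi !addr_ge0 ?tail_ge0// mulr_ge0 ?invr_ge0 ?mulr_ge0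
    ?(ltW c0) ?(ltW C0)//.
  case: dphi => -[_ ph] _ _ _ _; apply: ph; split; near: k => //.
- near=> k => xk.
  have Fk : 0 < f (x k) - f xbar by rewrite subr_gt0; near: k.
  have Dk : ((D k)%:E < eta)%E by near: k.
  have Dk1 : 0 <= D k.+1 by near: k.
  have deck : c * t k * enorm (grad f (x k)) ^+ 2 <= D k - D k.+1.
    have -> : D k - D k.+1 =
      (f (x k) + tail w k) - (f (x k.+1) + tail w k.+1) by rewrite /D; ring.
    by near: k.
  have Flt : ((f (x k) - f xbar)%:E < eta)%E.
    by apply: le_lt_trans Dk; rewrite lee_fin lerDl ltW.
  have ult : (tail_sum w k < eta)%E.
    by rewrite tail_sumE//; apply: le_lt_trans Dk; rewrite lee_fin lerDr ltW.
  have KLk : 1 <= derive1 phi (f (x k) - f xbar) * enorm (grad f (x k)).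
    by apply: KL => //; apply: rU; rewrite -ball_normE.
  have := KL_step_length dphi qa C0 c0 (t0 k) (enorm_ge0 _) Fk (u0 k) Dk Dk1
    KLk deck.
  have stepk : `|x k.+1 - x k| <= t k * enorm (grad f (x k)) + w k by near: k.
  have -> : t k * (derive1 phi (tail w k))^-1 = v k by rewrite /v ult.
  have := tailS w0' wsum k; have := tailS v0 vsum k.
  rewrite /Psi -/(D k); lra.
Unshelve. all: by end_near. Qed.

Theorem corollary3p5 (R : realType) (n : nat) (f : 'rV[R]_n -> R) (L : R)
    (x d : nat -> 'rV[R]_n) (rho t : nat -> R)
    (L_gt0 : 0 < L) (f_C1 : C1_fun f) (f_lip : lipschitz_grad L f)
    (d_neq0 : forall k, d k != 0)
    (rho_gt0 : forall k, 0 < rho k) (t_gt0 : forall k, 0 < t k)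
    (x_rec : forall k,
      x k.+1 =
      x k - t k *: grad f (x k + rho k *: ((enorm (d k))^-1 *: d k)))
    (t_sum : (\sum_(0 <= k <oo) (t k)%:E = +oo)%E)
    (t_cvg0 : t @ \oo --> (0 : R))
    (trho_sum : (\sum_(0 <= k <oo) (t k * rho k)%:E < +oo)%E)
    (rho_limsup : (limn_esup (fun k => (rho k)%:E) < (2 / L)%:E)%E)
    (f_inf : (-oo < ereal_inf (range (fun k => (f (x k))%:E)))%E) :
  [/\ (grad f (x k) @[k --> \oo] --> (0 : 'rV[R]_n)) /\
      (forall xbar, accumulation_point x xbar -> stationary f xbar),
      (forall xbar, accumulation_point x xbar ->
         f (x k) @[k --> \oo] --> f xbar),
      (forall (xbar : 'rV[R]_n) (eta : \bar R) (phi : R -> R),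
         accumulation_point x xbar ->
         KL_with f xbar eta phi ->
         (exists2 C : R, 0 < C & quasi_additive eta phi C) ->
         summable_desing eta phi t (fun k => L * rho k) ->
         (\forall k \near \oo, f xbar < f (x k)) ->
         x @ \oo --> xbar) &
      (forall (xbar : 'rV[R]_n) (eta : \bar R) (phi : R -> R),
         accumulation_point x xbar ->
         KL_with f xbar eta phi ->
         (exists2 C : R, 0 < C & quasi_additive eta phi C) ->
         summable_desing eta phi t (fun k => L * rho k) ->
         (forall y, f xbar <= f y) ->
         (exists k, f (x k) = f xbar) \/ x @ \oo --> xbar)].
Proof.
have [fdiff gradC] := f_C1.
pose eps k := L * rho k; pose w k := t k * (L * rho k).
have eps_gt0 k : 0 < eps k by rewrite mulr_gt0.
have w_gt0 k : 0 < w k by rewrite !mulr_gt0.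
have w_ge0 k : 0 <= w k := ltW (w_gt0 k).
have w_sum : (\sum_(0 <= k <oo) (w k)%:E < +oo)%E.
  rewrite (eq_eseriesr (g := fun k => (L%:E * (t k * rho k)%:E)%E)); last first.
    by move=> k _; rewrite -EFinM /w mulrCA.
  rewrite nneseriesZl; last by move=> k _; rewrite lee_fin mulr_ge0// ltW.
  by rewrite lte_mul_pinfty// lee_fin ltW.
have [m mL rho_m] := near_le_of_limn_esup_lt rho_limsup.
(* Any [m] between the limsup and [2 / L] will do; [c] is chosen such that
   [L * m = 2 - 4 * c]. *)
pose c := (2 - L * m) / 4.
have c_gt0 : 0 < c.
  by rewrite divr_gt0// subr_gt0 mulrC -ltr_pdivlMr.
have epsc : \forall k \near \oo, eps k <= 2 - 4 * c.
  apply: filterS rho_m => k rhok.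
  have -> : 2 - 4 * c = L * m by rewrite /c; field.
  by rewrite ler_pM2l.
clearbody c.
have tsmall b : 0 < b -> \forall k \near \oo, t k <= b.
  by move=> b0; apply: (cvgr_le 0).
pose g k := grad f (x k + rho k *: ((enorm (d k))^-1 *: d k)).
have gE k : enorm (g k - grad f (x k)) <= eps k.
  apply: le_trans (f_lip _ _) _; rewrite addrAC subrr add0r.
  rewrite enormZ gtr0_norm// enormZ normfV ger0_norm ?enorm_ge0//.
  by rewrite mulVf ?mulr1// enorm_eq0.
pose Phi k := f (x k) + tail w k.
have dec : \forall k \near \oo,
    c * t k * enorm (grad f (x k)) ^+ 2 <= Phi k - Phi k.+1.
  near=> k.
  have := @sufficient_decrease _ _ f L (t k) (eps k) c (x k) (g k) L_gt0 fdiff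
    f_lip (t_gt0 k) (eps_gt0 k).
  have tc : 2 * L * t k <= c.
    rewrite -ler_pdivlMl ?mulr_gt0//; near: k; apply: tsmall.
    by rewrite !(mulr_gt0, invr_gt0).
  have t8 : 8 * L * t k <= 1.
    rewrite -ler_pdivlMl ?mulr_gt0//; near: k; apply: tsmall.
    by rewrite !(mulr_gt0, invr_gt0).
  have ek : eps k <= 2 - 4 * c by near: k.
  move=> /(_ ek tc t8 (gE k)); rewrite -x_rec /Phi (tailS w_ge0 w_sum k).
  rewrite /w /eps; lra.
have inc : \forall k \near \oo,
    enorm (grad f (x k.+1)) ^+ 2 <= enorm (grad f (x k)) ^+ 2 +
      (1 + 8 * L ^+ 2) * (t k * enorm (grad f (x k)) ^+ 2 +
        (tail w k - tail w k.+1)).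
  near=> k.
  have t1 : t k <= 1 by near: k; exact: tsmall.
  have e2 : eps k <= 2.
    apply: (@le_trans _ _ (2 - 4 * c)); first by near: k.
    by rewrite gerBl mulr_ge0// ltW.
  have := grad_sqr_increment f_lip L_gt0 (t_gt0 k) t1 (eps_gt0 k) e2 (gE k).
  by rewrite -x_rec (tailS w_ge0 w_sum k) addrK.
have [b fb] : exists b, forall k, b <= f (x k).
  have fb k : (ereal_inf (range (fun k => (f (x k))%:E)) <= (f (x k))%:E)%E.
    by apply: ereal_inf_lbound; exists k.
  move: f_inf fb; case: (ereal_inf _) => [b| |]// _ fb.
    by exists b => k; rewrite -lee_fin.
  by have := fb 0%N.
have Phi_ge : \forall k \near \oo, b <= Phi k.
  by apply: nearW => k; rewrite -[b]addr0 lerD// tail_ge0.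
have tail0 := tail_cvg0 w_ge0 w_sum.
have grad_sqr0 : enorm (grad f (x k)) ^+ 2 @[k --> \oo] --> (0 : R).
  apply: (@quasi_descent_cvg0 _ t _ Phi (tail w) c (1 + 8 * L ^+ 2) b) => //.
  - by rewrite ltr_pwDl// mulr_ge0// sqr_ge0.
  - by move=> k; exact: sqr_ge0.
  - by move=> k; exact: tail_ge0.
  - by apply: cvgP tail0.
have f_is_cvg : cvgn (fun k => f (x k)).
  have -> : (fun k => f (x k)) = Phi - tail w.
    by apply/funext => k; rewrite !fctE /Phi addrK.
  apply: is_cvgB; last exact: cvgP tail0.
  apply: near_nonincreasing_step_cvg Phi_ge; apply: filterS dec => k.
  rewrite -[Phi k.+1 <= _]subr_ge0; apply: le_trans.
  by apply: mulr_ge0 (sqr_ge0 _); exact: mulr_ge0 (ltW _) (ltW _).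
have grad0 : grad f (x k) @[k --> \oo] --> (0 : 'rV[R]_n).
  apply/cvgr0Pnorm_lt => e e0; near=> k.
  apply: le_lt_trans (normr_le_enorm _) _.
  rewrite -(@ltr_pXn2r _ 2) ?nnegrE ?enorm_ge0 ?(ltW e0)//.
  by near: k; apply: (cvgr_lt 0) => //; rewrite exprn_gt0.
have f_cvg xbar : accumulation_point x xbar -> f (x k) @[k --> \oo] --> f xbar.
  move=> clx.
  rewrite -(@cvg_image_cluster _ _ x f xbar _ (@norm_hausdorff _ _) clx _ f_is_cvg)//.
  exact: differentiable_continuous.
have step : \forall k \near \oo,
    `|x k.+1 - x k| <= t k * enorm (grad f (x k)) + w k.
  apply: nearW => k.
  rewrite x_rec addrAC subrr add0r normrN normrZ gtr0_norm// /w -mulrDr.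
  rewrite ler_pM2l// -/(g k) -[g k](subrK (grad f (x k))) addrC.
  apply: le_trans (ler_normD _ _) _; apply: lerD; first exact: normr_le_enorm.
  exact: le_trans (normr_le_enorm _) (gE k).
have KLcvg xbar eta phi : accumulation_point x xbar -> KL_with f xbar eta phi ->
    (exists2 C : R, 0 < C & quasi_additive eta phi C) ->
    summable_desing eta phi t (fun k => L * rho k) ->
    (\forall k \near \oo, f xbar < f (x k)) -> x @ \oo --> xbar.
  move=> clx KL [C C0 qa] vsum above.
  exact: (KL_convergence t_gt0 w_gt0 w_sum c_gt0 dec step (f_cvg _ clx) clx KL C0
    qa vsum above).
split => //.
- split=> // xbar clx; rewrite /stationary; apply/esym.
  exact: (cvg_image_cluster (@norm_hausdorff _ _) clx (gradC xbar) grad0).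
- move=> xbar eta phi clx KL qa vsum fmin.
  have [[k fk]|nofk] := pselect (exists k, f (x k) = f xbar).
    by left; exists k.
  right; apply: KLcvg clx KL qa vsum _; apply: nearW => k.
  rewrite lt_neqAle fmin andbT; apply/eqP => fk.
  by apply: nofk; exists k.
Unshelve. all: by end_near. Qed.
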